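(* Let $k$ be a field and let $S=\{p_1,\dots,p_r\}$ be a finite set of distinct monomials of positive degree in variables $x_1,\dots,x_d$, indexed so that conditions (1) and (2) of the context hold. For $i<j$ let $m_{ij}=\frac{\mathrm{lcm}(p_i,p_j)}{p_j}$. For every integer $a\ge 1$, with $M_a$, $U_{x_a}$, $q_j$ and $(0:x_a)_{M_a}$ as defined in the context, $$\mathrm{HF}\{(0:x_a)_{M_a}\}=\delta(a)\,\mathrm{HF}\{k[x_1,\dots,x_{a-1}](-\deg q_1)\}+\sum_{j}\mathrm{HF}\big\{\big(k[x_1,\dots,x_{a-1}]/\langle m_{1j},m_{2j},\dots,m_{(j-1)j}\rangle\big)(-\deg q_j)\big\},$$ where the sum runs over all indices $j>1$ with $p_j\in S_a\setminus S_{a-1}$ (that is, $q_j\in U_{x_a}$), and where $\delta(a)=1$ if $q_1\in U_{x_a}$ (that is, $p_1\in S_a\setminus S_{a-1}$) and $\delta(a)=0$ otherwise.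
   Context: Extend the variables to an infinite list $x_1,\dots,x_d,x_{d+1},\dots$. Set $S_0=\emptyset$ and, for $a\ge 1$, $S_a=\{p_i\in S: p_i\in k[x_1,\dots,x_a]\}$. The indexing of $S$ is assumed to satisfy: (1) generators are listed in the order in which the variables are introduced: for every $a$, if $p_i\in S_a$ and $p_j\notin S_a$ then $i<j$; (2) for every $a\ge1$ and $p_i,p_j\in S_a$, $j>i$ only if the highest power of $x_a$ dividing $p_i$ also divides $p_j$. Let $I_a$ be the ideal of $k[x_1,\dots,x_a]$ generated by $S_a$ (with $I_a=0$ if $S_a=\emptyset$) and $M_a=k[x_1,\dots,x_a]/I_a$, graded by total degree. For $p_i\in S_a\setminus S_{a-1}$ put $q_i=p_i/x_a$, and let $U_{x_a}=\{q_i: p_i\in S_a\setminus S_{a-1}\}$ (empty if $S_a=S_{a-1}$). Let $(0:x_a)_{M_a}=\{g\in M_a: x_ag=0\}$ be the kernel of multiplication by $x_a$ on $M_a$, graded as a submodule of $M_a$. When $a=1$, $k[x_1,\dots,x_{a-1}]$ means $k$. For a graded module $M$, $\mathrm{HF}\{M\}$ denotes the function $t\mapsto \mathrm{HF}(M,t)=\dim_k M_t$ (zero for $t<0$), and $\mathrm{HF}\{M(-e)\}$ denotes the function $t\mapsto\mathrm{HF}(M,t-e)$. The monomials $m_{ij}$ appearing in the formula lie in $k[x_1,\dots,x_{a-1}]$ by the indexing conditions. *)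

(* Defs.v *)
From HB Require Import structures.
From mathcomp Require Import all_boot all_algebra.
From mathcomp Require Import boolp mpoly.

Set Implicit Arguments.
Unset Strict Implicit.
Unset Printing Implicit Defensive.

Import GRing.Theory.
Local Open Scope ring_scope.

Section IdealQuotient.
Variables (k : fieldType) (A : comAlgType k).
Implicit Types (gs : seq A) (f g : A).

Definition ideal_gen gs : {pred A} :=
  fun f => `[< exists c : nat -> A, f = \sum_(i < size gs) c i * gs`_i >].

Lemma ideal_genP gs f :
  reflect (exists c : nat -> A, f = \sum_(i < size gs) c i * gs`_i)
          (f \in ideal_gen gs).
Proof. exact: asboolP. Qed.

Lemma ideal_gen_zmod_closed gs : zmod_closed (ideal_gen gs).
Proof.
split=> [|f g /ideal_genP[c ->] /ideal_genP[c' ->]]; apply/ideal_genP.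
  by exists (fun=> 0); rewrite big1 // => i _; rewrite mul0r.
exists (fun i => c i - c' i); rewrite -sumrB.
by apply: eq_bigr => i _; rewrite mulrBl.
Qed.

HB.instance Definition _ gs :=
  GRing.isZmodClosed.Build A (ideal_gen gs) (ideal_gen_zmod_closed gs).

Lemma ideal_genM gs f g : g \in ideal_gen gs -> f * g \in ideal_gen gs.
Proof.
move=> /ideal_genP[c ->]; apply/ideal_genP; exists (fun i => f * c i).
by rewrite mulr_sumr; apply: eq_bigr => i _; rewrite mulrA.
Qed.

(* A/<gs>.  The library's ring structure on quotients needs a proper ideal, but
   the unit ideal must be allowed here, so this is a possibly zero ring (and,
   as the library's algebras are nonzero, a k-module compatible with the
   product by quo_scaleAl). *)
Definition quo_ring gs : Type := Quotient.quot (ideal_gen gs).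

HB.instance Definition _ gs := Choice.on (quo_ring gs).
HB.instance Definition _ gs := GRing.Zmodule.on (quo_ring gs).

Definition quo_pi gs : A -> quo_ring gs := \pi_(Quotient.quot (ideal_gen gs))%qT.
Definition quo_repr gs (x : quo_ring gs) : A :=
  repr (x : Quotient.quot (ideal_gen gs)).

Lemma quo_reprK gs : cancel (@quo_repr gs) (quo_pi gs).
Proof. exact: reprK. Qed.

Lemma quo_piP gs f g : (quo_pi gs f == quo_pi gs g) = (f - g \in ideal_gen gs).
Proof. by rewrite Quotient.idealrBE. Qed.

Lemma quo_piD gs : {morph quo_pi gs : f g / f + g}.
Proof. by move=> f g; rewrite /quo_pi raddfD. Qed.

Definition quo_mul gs (x y : quo_ring gs) : quo_ring gs :=
  quo_pi gs (quo_repr x * quo_repr y).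
Definition quo_scale gs (c : k) (x : quo_ring gs) : quo_ring gs :=
  quo_pi gs (c *: quo_repr x).

Lemma quo_piM gs : {morph quo_pi gs : f g / f * g >-> quo_mul f g}.
Proof.
move=> f g; apply/eqP; rewrite /quo_mul quo_piP.
have E h : h - quo_repr (quo_pi gs h) \in ideal_gen gs.
  by rewrite -quo_piP quo_reprK.
set f' := quo_repr _; set g' := quo_repr _.
have -> : f * g - f' * g' = g * (f - f') + f' * (g - g').
  by rewrite !mulrBr [g * f]mulrC [g * f']mulrC addrA subrK.
by rewrite rpredD // ideal_genM // E.
Qed.

Lemma quo_piZ gs c : {morph quo_pi gs : f / c *: f >-> quo_scale c f}.
Proof.
move=> f; apply/eqP; rewrite /quo_scale quo_piP -scalerBr -mulr_algl.
by rewrite ideal_genM // -quo_piP quo_reprK.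
Qed.

Lemma quo_ind gs (P : quo_ring gs -> Prop) :
  (forall f, P (quo_pi gs f)) -> forall x, P x.
Proof. by move=> H x; rewrite -(quo_reprK x). Qed.

Lemma quo_mulA gs : associative (@quo_mul gs).
Proof.
elim/quo_ind=> f; elim/quo_ind=> g; elim/quo_ind=> h.
by rewrite -!quo_piM mulrA.
Qed.

Lemma quo_mulC gs : commutative (@quo_mul gs).
Proof. by elim/quo_ind=> f; elim/quo_ind=> g; rewrite -!quo_piM mulrC. Qed.

Lemma quo_mul1 gs : left_id (quo_pi gs 1) (@quo_mul gs).
Proof. by elim/quo_ind=> f; rewrite -!quo_piM mul1r. Qed.

Lemma quo_mulDl gs : left_distributive (@quo_mul gs) +%R.
Proof.
elim/quo_ind=> f; elim/quo_ind=> g; elim/quo_ind=> h.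
by rewrite -quo_piD -!quo_piM mulrDl quo_piD.
Qed.

HB.instance Definition _ gs := GRing.Zmodule_isComPzRing.Build (quo_ring gs)
  (@quo_mulA gs) (@quo_mulC gs) (@quo_mul1 gs) (@quo_mulDl gs).

Lemma quo_scaleA gs a b (x : quo_ring gs) :
  quo_scale a (quo_scale b x) = quo_scale (a * b) x.
Proof. by elim/quo_ind: x => f; rewrite -!quo_piZ scalerA. Qed.

Lemma quo_scale1 gs : left_id 1 (@quo_scale gs).
Proof. by elim/quo_ind=> f; rewrite -!quo_piZ scale1r. Qed.

Lemma quo_scaleDr gs : right_distributive (@quo_scale gs) +%R.
Proof.
move=> c; elim/quo_ind=> f; elim/quo_ind=> g.
by rewrite -quo_piD -!quo_piZ scalerDr quo_piD.
Qed.

Lemma quo_scaleDl gs x : {morph (@quo_scale gs)^~ x : a b / a + b}.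
Proof. by move=> a b; elim/quo_ind: x => f; rewrite -!quo_piZ scalerDl quo_piD. Qed.

HB.instance Definition _ gs := GRing.Zmodule_isLmodule.Build k (quo_ring gs)
  (@quo_scaleA gs) (@quo_scale1 gs) (@quo_scaleDr gs) (@quo_scaleDl gs).

Lemma quo_scaleAl gs c (x y : quo_ring gs) : c *: (x * y) = (c *: x) * y.
Proof.
elim/quo_ind: x => f; elim/quo_ind: y => g.
change (quo_scale c (quo_mul (quo_pi gs f) (quo_pi gs g)) =
  quo_mul (quo_scale c (quo_pi gs f)) (quo_pi gs g)).
by rewrite -quo_piM -!quo_piZ -quo_piM scalerAl.
Qed.

End IdealQuotient.

Section HilbertFunction.
Variables (k : fieldType) (V : lmodType k).

Definition has_dim (W : V -> Prop) (n : nat) : Prop :=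
  exists e : 'I_n -> V,
    [/\ forall i, W (e i),
        forall v, W v -> exists c : 'I_n -> k, v = \sum_(i < n) c i *: e i
      & forall c : 'I_n -> k, \sum_(i < n) c i *: e i = 0 -> forall i, c i = 0].

(* dim_k W; the value 0 given to infinite-dimensional W is never reached below,
   where W is a graded piece of a subquotient of a polynomial ring. *)
Definition dimk (W : V -> Prop) : nat :=
  if pselect (exists n, has_dim W n) is left h then projT1 (cid h) else 0%N.

(* A graded k-space is given by the family of its graded pieces; the degree t
   ranges over the integers because of the shifts M(-e). *)
Definition HF (M : nat -> V -> Prop) (t : int) : nat :=
  if t is Posz n then dimk (M n) else 0%N.

End HilbertFunction.

Section PolynomialQuotients.
Variables (k : fieldType) (n : nat).
Implicit Types (gs : seq {mpoly k[n]}) (t : nat).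

Definition poly_gr t (f : {mpoly k[n]}) : Prop := f \is t.-homog.

(* Degree t piece of k[x_1, ..., x_n]/<gs>; this is a grading when <gs> is
   homogeneous. *)
Definition quo_gr gs t (x : quo_ring gs) : Prop :=
  exists2 f : {mpoly k[n]}, f \is t.-homog & x = quo_pi gs f.

(* Degree t piece of the kernel (0 : f) of multiplication by f on
   k[x_1, ..., x_n]/<gs>. *)
Definition colon_gr gs (f : {mpoly k[n]}) t (x : quo_ring gs) : Prop :=
  @quo_gr gs t x /\ quo_pi gs f * x = 0.

End PolynomialQuotients.

Arguments poly_gr : clear implicits.
Arguments quo_gr {k n} gs t x.
Arguments colon_gr {k n} gs f t x.

(* Monomials in x_1, ..., x_d are elements of 'X_{1..d}, with x_b the variable
   of index b - 1; the infinite list of variables is obtained by reading the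
   exponents of x_{d+1}, x_{d+2}, ... as 0. *)
Section Monomials.
Variable d : nat.
Implicit Types (m : 'X_{1..d}) (p : seq 'X_{1..d}) (a b i j : nat).

(* Exponent of x_{b+1} in m. *)
Definition expo m b : nat := nth 0%N m b.

(* m lies in k[x_1, ..., x_a]. *)
Definition in_vars a m : bool := [forall i : 'I_d, (a <= i)%N ==> (m i == 0%N)].

(* m as a monomial of k[x_1, ..., x_a]; only meaningful when in_vars a m. *)
Definition to_vars a m : 'X_{1..a} := [multinom expo m i | i < a].

(* The list p = [:: p_1; ...; p_r] stands for S, so that p_{i+1} is gen p i. *)
Definition gen p i : 'X_{1..d} := nth 0%MM p i.

(* S_a; it is empty for a = 0 as soon as the p_i have positive degree. *)
Definition gens p a : seq 'X_{1..d} := [seq m <- p | in_vars a m].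

Definition ordered_by_vars p : Prop := forall a i j,
  (i < size p)%N -> (j < size p)%N ->
  gen p i \in gens p a -> gen p j \notin gens p a -> (i < j)%N.

(* Stated for the variable x_{a+1}: the highest power of x_{a+1} dividing p_i
   also divides p_j. *)
Definition ordered_by_powers p : Prop := forall a i j,
  (i < size p)%N -> (j < size p)%N ->
  gen p i \in gens p a.+1 -> gen p j \in gens p a.+1 ->
  (i < j)%N -> (expo (gen p i) a <= expo (gen p j) a)%N.

(* p_{j+1} belongs to S_{a+1} but not to S_a, i.e. q_{j+1} is in U_{x_{a+1}}. *)
Definition new_gen p a j : bool :=
  (gen p j \in gens p a.+1) && (gen p j \notin gens p a).

(* q_{j+1} = p_{j+1} / x_{a+1}. *)
Definition qmon p a j : 'X_{1..a.+1} :=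
  (to_vars a.+1 (gen p j) - U_(ord_max))%MM.

(* m_{i+1,j+1} = lcm(p_{i+1}, p_{j+1}) / p_{j+1}. *)
Definition mmon p i j : 'X_{1..d} := (mlcm (gen p i) (gen p j) - gen p j)%MM.

End Monomials.

Section MonomialIdeals.
Variables (k : fieldType) (d : nat) (p : seq 'X_{1..d}).

(* The generators of I_a. *)
Definition Igens (a : nat) : seq {mpoly k[a]} :=
  [seq 'X_[to_vars a m] | m <- gens p a].

(* m_{1,j+1}, ..., m_{j,j+1}.  When p_{j+1} lies in S_{a+1} but not in S_a, the
   ordering conditions put these monomials in k[x_1, ..., x_a], and to_vars a
   changes nothing to them. *)
Definition mgens (a j : nat) : seq {mpoly k[a]} :=
  [seq 'X_[to_vars a (mmon p i j)] | i <- iota 0 j].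

End MonomialIdeals.

(* Main.v *)
From HB Require Import structures.
Require Import Defs.
From mathcomp Require Import all_boot all_algebra.
From mathcomp Require Import boolp mpoly zify.

Set Implicit Arguments.
Unset Strict Implicit.
Unset Printing Implicit Defensive.

Import GRing.Theory.
Local Open Scope ring_scope.

(** All the ideals involved are monomial, so every Hilbert function in the
    formula counts monomials, and the formula is a bijection.

    Write [x] for the last variable [x_(a+1)] and [I] for [I_(a+1)].  A
    polynomial lies in a monomial ideal iff each of its monomials does
    ([ideal_gen_monoP]).  Hence degree [t] of the quotient by a monomial ideal
    has as basis the monomials of degree [t] outside the ideal
    ([HF_quo_gr]), and degree [t] of the kernel of multiplication by [x] has as
    basis the monomials [u] of degree [t] with [u] outside [I] and [u x] in [I]
    ([HF_colon_gr]).  Such a set of monomials gives a dimension because the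
    dimension is unique ([dimkE]).

    Given such a [u], let [j] be the least index with [p_j] in [S_(a+1)]
    dividing [u x] ([first_gen]).  Since [p_j] does not divide [u], the exponent
    of [x] in [p_j] is exactly one more than in [u]; so [p_j] is a new generator
    and [u = q_j w] with [w] free of [x].  A product [p_j w] is divisible by
    an earlier [p_i] iff [m_ij] divides [w] ([lem_syzygy]), so minimality of
    [j] says that [w] lies outside [<m_1j, ..., m_(j-1)j>].  Conversely, for
    [w] outside this ideal put [u = q_j w].  Then [u x = p_j w] lies in [I], and
    no [p_i] divides [u]: an earlier one would divide [p_j w], and [p_j] or a
    later one has too large an exponent of [x] by the second ordering
    condition.  Thus [u] and the pair [(j, w)] determine each other
    ([fiberP]), and counting the [u] by the value of [j] gives the formula. *)

(** * Uniqueness of dimension *)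

Section Dimension.
Variables (k : fieldType) (V : lmodType k).
Implicit Types (W : V -> Prop).

(** The change of basis matrices between the two bases have product the
    identity of size [m], whose rank is at most the inner dimension [n]. *)
Lemma has_dim_leq W m n : has_dim W m -> has_dim W n -> (m <= n)%N.
Proof.
move=> [e [We spane freee]] [f [Wf spanf _]].
have [A AE] := choice (fun i => spanf _ (We i)).
have [B BE] := choice (fun j => spane _ (Wf j)).
pose MA : 'M[k]_(m, n) := \matrix_(i, j) A i j.
pose MB : 'M[k]_(n, m) := \matrix_(j, i) B j i.
suff AB1 : MA *m MB = 1%:M by rewrite -(mxrank1 k m) -AB1 mulmx_max_rank.
(* The difference of the two entries is the coefficient of [e i'] in a linear
   relation among the basis vectors: expand [e i] in [f], then back in [e]. *)
apply/matrixP => i i'; apply/eqP; rewrite -subr_eq0; apply/eqP.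
pose c i' : k := (MA *m MB) i i' - (1%:M : 'M[k]_m) i i'.
rewrite -/(c i'); apply: freee.
under eq_bigr => l _ do rewrite scalerBl.
rewrite sumrB [X in _ - X](bigD1 i) //= [X in _ - (_ + X)]big1; last first.
  by move=> l; rewrite mxE eq_sym => /negPf->; rewrite scale0r.
rewrite mxE eqxx scale1r addr0 [X in _ - X]AE; apply/eqP; rewrite subr_eq0.
apply/eqP; under [RHS]eq_bigr => j _ do rewrite BE scaler_sumr.
rewrite exchange_big; apply: eq_bigr => l _ /=.
rewrite mxE scaler_suml; apply: eq_bigr => j _.
by rewrite !mxE scalerA.
Qed.

Lemma dimkE W n : has_dim W n -> dimk W = n.
Proof.
move=> Wn; rewrite /dimk; case: pselect => [h|[]]; last by exists n.
case: (cid h) => m Wm /=; apply/eqP.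
by rewrite eqn_leq !(has_dim_leq Wm, has_dim_leq Wn).
Qed.

End Dimension.

(** * Hilbert functions of monomial ideals *)

Section MonomialBasis.
Variables (k : fieldType) (n : nat).
Implicit Types (f : {mpoly k[n]}) (u v g : 'X_{1..n}) (B G : seq 'X_{1..n}).

Definition restrict B f : {mpoly k[n]} := \sum_(u <- B) f@_u *: 'X_[u].

Lemma mcoeff_comb (c : 'X_{1..n} -> k) B u : uniq B ->
  (\sum_(v <- B) c v *: 'X_[v])@_u = if u \in B then c u else 0.
Proof.
move=> uB; rewrite raddf_sum /=.
under eq_bigr => v _ do rewrite mcoeffZ mcoeffX.
case: ifP => [uinB|uB']; last first.
  rewrite big_seq big1 // => v vB; case: eqP => [vu|]; last by rewrite mulr0.
  by rewrite -vu vB in uB'.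
rewrite (bigD1_seq u) //= eqxx mulr1 big1 ?addr0 // => v /negPf->.
by rewrite mulr0.
Qed.

Lemma mcoeff_restrict B f u : uniq B ->
  (restrict B f)@_u = if u \in B then f@_u else 0.
Proof. exact: (mcoeff_comb (fun u => f@_u)). Qed.

(** An arbitrary linear map out of the polynomial ring covers both the ring
    itself and its quotients. *)
Lemma dimk_monomials (V : lmodType k) (phi : {linear {mpoly k[n]} -> V})
    (W : V -> Prop) B :
    uniq B ->
    {in B, forall u, W (phi 'X_[u])} ->
    (forall x, W x -> exists f, x = phi (restrict B f)) ->
    (forall f, {subset msupp f <= B} -> phi f = 0 -> f = 0) ->
  dimk W = size B.
Proof.
move=> uB WB spanB freeB; apply: dimkE.
exists (fun i => phi 'X_[tnth (in_tuple B) i]); split.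
- by move=> i; apply/WB/mem_tnth.
- move=> x /spanB[f ->]; exists (fun i => f@_(tnth (in_tuple B) i)).
  by rewrite linear_sum big_tnth; apply: eq_bigr => i _; rewrite linearZ.
(* Independence: reindex the coefficients by the monomials of [B], to view the
   relation as the image of a polynomial supported in [B]. *)
move=> c c0 i; pose b u := if insub (index u B) is Some j then c j else 0.
have bE j : b (tnth (in_tuple B) j) = c j.
  rewrite /b (tnth_nth 0%MM) index_uniq //= insubT //= => lt_j.
  by congr c; apply: val_inj.
pose f := \sum_(u <- B) b u *: ('X_[u] : {mpoly k[n]}).
have f0 : f = 0.
  apply: freeB => [u|].
    by rewrite mcoeff_msupp mcoeff_comb //; case: ifP => //; rewrite eqxx.
  rewrite -c0 linear_sum big_tnth; apply: eq_bigr => j _.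
  by rewrite linearZ bE.
rewrite -bE; have := mcoeff_comb b (tnth (in_tuple B) i) uB.
by rewrite -/f f0 mcoeff0 mem_tnth.
Qed.

Definition in_mono G u : bool := has (fun g => (g <= u)%MM) G.

(** The monomials of a combination of the [g] are multiples of some [g]; and a
    polynomial whose monomials all are multiples is a sum of elements of the
    ideal. *)
Lemma ideal_gen_monoP G f :
  reflect {in msupp f, forall u, in_mono G u}
          (f \in ideal_gen [seq 'X_[g] | g <- G]).
Proof.
apply: (iffP idP) => [/ideal_genP[c ->] u|fG].
  move/msupp_sum_le/flattenP => [s /mapP[i _ ->]].
  have lt_i : (i < size G)%N by case: i => i /=; rewrite size_map.
  rewrite (nth_map 0%MM) // (perm_mem (msuppMX _ _)) => /mapP[v _ ->].
  by apply/hasP; exists (nth 0%MM G i); rewrite ?mem_nth ?lem_addr.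
rewrite [f]mpolyE big_seq; apply: rpred_sum => u /fG/hasP[g gG le_gu].
rewrite -(submK le_gu) mpolyXD scalerAl; apply: ideal_genM.
apply/ideal_genP; exists (fun i => (i == index g G)%:R).
have lt_g : (index g G < size G)%N by rewrite index_mem.
rewrite size_map (bigD1 (Ordinal lt_g)) //= eqxx mul1r big1 => [|i].
  by rewrite (nth_map 0%MM) // nth_index // addr0.
by rewrite -val_eqE /= => /negPf->; rewrite mul0r.
Qed.

(** The bounded monomials form a finite type, which yields the finite list of
    all the monomials of a given degree. *)
Definition deg_monos t : seq 'X_{1..n} :=
  [seq u <- [seq bmnm w | w <- enum {: 'X_{1..n < t.+1}}] | mdeg u == t].

Lemma mem_deg_monos t u : (u \in deg_monos t) = (mdeg u == t).
Proof.
rewrite mem_filter; case: eqP => //= ut.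
have lt_u : (mdeg u < t.+1)%N by rewrite ut.
by apply/mapP; exists (BMultinom lt_u); rewrite ?mem_enum.
Qed.

Lemma deg_monos_uniq t : uniq (deg_monos t).
Proof.
by rewrite filter_uniq // map_inj_uniq ?enum_uniq //; apply: val_inj.
Qed.

Lemma quo_pi_linear (gs : seq {mpoly k[n]}) :
  linear (@quo_pi k {mpoly k[n]} gs).
Proof. by move=> c f g; rewrite quo_piD quo_piZ. Qed.

HB.instance Definition _ (gs : seq {mpoly k[n]}) :=
  GRing.isLinear.Build k {mpoly k[n]} (quo_ring gs) _
    (@quo_pi k {mpoly k[n]} gs) (quo_pi_linear gs).

Lemma HF_poly_gr (t : nat) : HF (poly_gr k n) t = size (deg_monos t).
Proof.
apply: (dimk_monomials (phi := idfun)) (deg_monos_uniq t) _ _ _ => //.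
  by move=> u; rewrite mem_deg_monos /poly_gr /= dhomogX.
move=> f /dhomogP ft; exists f; apply/mpolyP=> u.
rewrite mcoeff_restrict ?deg_monos_uniq // mem_deg_monos.
case: eqP => // ut; apply/eqP; rewrite mcoeff_eq0.
by apply/negP => /ft.
Qed.

Lemma quo_pi_eq0 (gs : seq {mpoly k[n]}) f :
  (quo_pi gs f == 0) = (f \in ideal_gen gs).
Proof. by rewrite -(raddf0 (quo_pi gs)) quo_piP subr0. Qed.

(** The degree [t] pieces of quotients and of colon modules are both spanned by
    the classes of the monomials satisfying some [Q]; those inside the ideal
    vanish and the others are independent. *)
Lemma dimk_quo G (Q : pred 'X_{1..n}) t
    (W : quo_ring [seq ('X_[g] : {mpoly k[n]}) | g <- G] -> Prop) :
  (forall u, mdeg u = t -> Q u -> W (quo_pi _ 'X_[u])) ->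
  (forall x, W x -> exists2 f, x = quo_pi _ f
     & {in msupp f, forall u, mdeg u = t /\ (~~ in_mono G u -> Q u)}) ->
  dimk W = count (fun u => ~~ in_mono G u && Q u) (deg_monos t).
Proof.
move=> WQ spanQ; rewrite -size_filter.
set B := filter _ _.
have uB : uniq B by rewrite filter_uniq ?deg_monos_uniq.
have memB u : (u \in B) = [&& ~~ in_mono G u, Q u & mdeg u == t].
  by rewrite mem_filter mem_deg_monos andbA.
apply: (dimk_monomials (phi := quo_pi [seq 'X_[g] | g <- G])) (uB) _ _ _ => /=.
- by move=> u; rewrite memB => /and3P[_ Qu /eqP ut]; apply: WQ.
(* The part of [f] inside the ideal can be dropped. *)
- move=> x /spanQ[f -> fQ]; exists f; apply/eqP; rewrite quo_piP.
  apply/ideal_gen_monoP=> u; rewrite mcoeff_msupp mcoeffB mcoeff_restrict //.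
  case: ifPn => [|uB' /negP nz]; first by rewrite subrr eqxx.
  apply/negPn/negP => uG; apply: nz; rewrite subr0 mcoeff_eq0.
  apply/negP => /fQ[ut /(_ uG) Qu].
  by move: uB'; rewrite memB uG Qu ut eqxx.
move=> f fB /eqP; rewrite quo_pi_eq0 => /ideal_gen_monoP fG.
apply/mpolyP => u; rewrite mcoeff0; apply/eqP; rewrite mcoeff_eq0.
by apply/negP => uf; have := fB u uf; rewrite memB fG.
Qed.

Lemma HF_quo_gr G (t : nat) :
  HF (quo_gr [seq ('X_[g] : {mpoly k[n]}) | g <- G]) t =
  count (fun u => ~~ in_mono G u) (deg_monos t).
Proof.
rewrite /HF (@dimk_quo G predT t); first by apply: eq_count => u; rewrite andbT.
  by move=> u ut _; exists 'X_[u]; rewrite ?dhomogX //; apply/eqP.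
by move=> x [f /dhomogP ft ->]; exists f => // u /ft.
Qed.

Lemma HF_colon_gr G v (t : nat) :
  HF (colon_gr [seq ('X_[g] : {mpoly k[n]}) | g <- G] 'X_[v]) t =
  count (fun u => ~~ in_mono G u && in_mono G (u + v)%MM) (deg_monos t).
Proof.
rewrite /HF; apply: dimk_quo => [u ut uvG|x [[f /dhomogP ft ->]]].
  split; first by exists 'X_[u]; rewrite ?dhomogX //; apply/eqP.
  apply/eqP; rewrite -[_ * _]quo_piM quo_pi_eq0 -mpolyXD addmC.
  by apply/ideal_gen_monoP => w /mem_msuppXP <-.
move/eqP; rewrite -[_ * _]quo_piM quo_pi_eq0 mulrC => /ideal_gen_monoP fvG.
exists f => // u uf; split; first exact: ft.
by move=> _; apply: fvG; rewrite (perm_mem (msuppMX _ _)) addmC map_f.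
Qed.

End MonomialBasis.

(** * Monomials through their exponents *)

(** The total function [expo] compares monomials in different numbers of
    variables without casts between ordinals. *)
Section Exponents.
Variable n : nat.
Implicit Types (m : 'X_{1..n}).

Lemma expoE m (i : 'I_n) : expo m i = m i.
Proof. by rewrite /expo -mnm_nth. Qed.

Lemma expo_default m b : (n <= b)%N -> expo m b = 0%N.
Proof. by move=> le_nb; rewrite /expo nth_default // size_tuple. Qed.

Lemma lem_expoP m m' :
  reflect (forall b, (expo m b <= expo m' b)%N) (m <= m')%MM.
Proof.
apply: (iffP mnm_lepP) => [le_m b|le_m i]; last by rewrite -!expoE.
have [lt_b|le_b] := ltnP b n; last by rewrite !expo_default.
by rewrite -[b]/(val (Ordinal lt_b)) !expoE.
Qed.

Lemma expo_inj m m' : expo m =1 expo m' -> m = m'.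
Proof. by move=> eq_m; apply/mnmP => i; rewrite -!expoE. Qed.

Lemma expo0 b : expo (0%MM : 'X_{1..n}) b = 0%N.
Proof.
have [lt_b|le_b] := ltnP b n; last by rewrite expo_default.
by rewrite -[b]/(val (Ordinal lt_b)) expoE mnm0E.
Qed.

Lemma expoD m m' b : expo (m + m')%MM b = (expo m b + expo m' b)%N.
Proof.
have [lt_b|le_b] := ltnP b n; last by rewrite !expo_default.
by rewrite -[b]/(val (Ordinal lt_b)) !expoE mnmDE.
Qed.

Lemma expoB m m' b : expo (m - m')%MM b = (expo m b - expo m' b)%N.
Proof.
have [lt_b|le_b] := ltnP b n; last by rewrite !expo_default.
by rewrite -[b]/(val (Ordinal lt_b)) !expoE mnmBE.
Qed.

Lemma expo_lcm m m' b : expo (mlcm m m') b = maxn (expo m b) (expo m' b).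
Proof.
have [lt_b|le_b] := ltnP b n; last by rewrite !expo_default.
by rewrite -[b]/(val (Ordinal lt_b)) !expoE mnmE.
Qed.

Lemma expoU (i : 'I_n) b : expo (U_(i)%MM : 'X_{1..n}) b = (val i == b).
Proof.
have [lt_b|le_b] := ltnP b n; last first.
  by rewrite expo_default // ltn_eqF // (leq_trans (ltn_ord i)).
by rewrite -[b]/(val (Ordinal lt_b)) expoE mnm1E.
Qed.

Lemma expo_to_vars a m b :
  expo (to_vars a m) b = if (b < a)%N then expo m b else 0%N.
Proof.
case: ltnP => [lt_b|le_b]; last first.
  by rewrite /expo nth_default // size_tuple.
by rewrite /expo -[b in LHS]/(val (Ordinal lt_b)) -mnm_nth mnmE.
Qed.

Lemma in_varsP a m :
  reflect (forall b, (a <= b)%N -> expo m b = 0%N) (in_vars a m).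
Proof.
apply: (iffP forallP) => [m0 b le_ab|m0 i]; last first.
  by apply/implyP => le_ai; rewrite -expoE m0.
have [lt_b|le_b] := ltnP b n; last by rewrite !expo_default.
have /implyP/(_ le_ab)/eqP := m0 (Ordinal lt_b).
by rewrite -expoE.
Qed.

End Exponents.

Lemma mdeg_to_vars n (m : 'X_{1..n}) : mdeg (to_vars n.+1 m) = mdeg m.
Proof.
rewrite !mdegE big_ord_recr /= -[X in (_ + X)%N]expoE expo_to_vars.
rewrite ltnSn expo_default // addn0; apply: eq_bigr => i _.
by rewrite -!expoE expo_to_vars /= ltnS ltnW.
Qed.

Lemma count_fibers (T : Type) (s : seq T) (P : pred T) (h : T -> nat) N :
    (forall x, P x -> h x < N)%N ->
  count P s = (\sum_(0 <= j < N) count (fun x => P x && (h x == j)) s)%N.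
Proof.
move=> hN; elim: s => [|x s IHs] /=; first by rewrite big1_eq.
rewrite big_split -IHs /= big_mkord; congr (_ + _)%N.
case: (boolP (P x)) => [/hN lt_x|_]; last by rewrite big1.
rewrite (bigD1 (Ordinal lt_x)) //= eqxx big1 // => j.
by rewrite -val_eqE eq_sym => /negPf /= ->.
Qed.

(** * The bijection between monomials of the colon module and pairs *)

Section Colon.
Variables (d : nat) (p : seq 'X_{1..d}) (a : nat).
Hypotheses (p_vars : ordered_by_vars p) (p_powers : ordered_by_powers p).

Notation lift_gen i := (to_vars a.+1 (gen p i)).
Notation x := (U_(@ord_max a))%MM.

Definition ideal_monos : seq 'X_{1..a.+1} :=
  [seq to_vars a.+1 m | m <- gens p a.+1].
Definition syzygy_monos j : seq 'X_{1..a} :=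
  [seq to_vars a (mmon p i j) | i <- iota 0 j].
Definition in_colon (u : 'X_{1..a.+1}) : bool :=
  ~~ in_mono ideal_monos u && in_mono ideal_monos (u + x)%MM.
Definition first_gen (u : 'X_{1..a.+1}) : nat :=
  find (fun m => in_vars a.+1 m && (to_vars a.+1 m <= u + x)%MM) p.

Lemma expo_x b : expo (x : 'X_{1..a.+1}) b = (b == a).
Proof. by rewrite expoU eq_sym. Qed.

Lemma gen_mem_gens b i : (i < size p)%N ->
  (gen p i \in gens p b) = in_vars b (gen p i).
Proof. by move=> lt_i; rewrite mem_filter mem_nth ?andbT. Qed.

Lemma mem_gensP b m :
  reflect (exists i, [/\ (i < size p)%N, in_vars b (gen p i) & m = gen p i])
    (m \in gens p b).
Proof.
rewrite mem_filter; apply: (iffP andP) => [[mb mp]|[i [lt_i ib ->]]].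
  by exists (index m p); rewrite /gen nth_index // index_mem.
by rewrite mem_nth.
Qed.

Lemma new_gen_lt j : new_gen p a j -> (j < size p)%N.
Proof.
case/andP; rewrite ltnNge !mem_filter => /andP[_ pj] pj'.
apply: contra pj' => le_j; rewrite pj andbT /gen nth_default //.
by apply/in_varsP => b _; apply: expo0.
Qed.

(** The first ordering condition, read contrapositively. *)
Lemma ordered_in_vars b i j : (i < j)%N -> (j < size p)%N ->
  in_vars b (gen p j) -> in_vars b (gen p i).
Proof.
move=> lt_ij lt_j pj; have lt_i := ltn_trans lt_ij lt_j.
apply: contraT => pi; have := @p_vars b j i lt_j lt_i.
by rewrite !gen_mem_gens // => /(_ pj pi); rewrite ltnNge ltnW.
Qed.

Lemma new_genP j : (j < size p)%N ->
  new_gen p a j = in_vars a.+1 (gen p j) && (0 < expo (gen p j) a)%N.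
Proof.
move=> lt_j; rewrite /new_gen !gen_mem_gens //.
case: in_varsP => //= pj; rewrite lt0n; congr (~~ _).
apply/in_varsP/eqP => [|pj0 b]; first exact.
by rewrite leq_eqVlt => /predU1P[<-|/pj].
Qed.

(** That is [x q_j w = p_j w]: the subtraction defining [q_j] is not truncated,
    because a new generator is divisible by [x]. *)
Lemma qmonE j (w : 'X_{1..a}) : new_gen p a j ->
  (qmon p a j + to_vars a.+1 w + x = lift_gen j + to_vars a.+1 w)%MM.
Proof.
move=> pj; have := pj; rewrite new_genP ?new_gen_lt // => /andP[_ pj0].
apply: expo_inj => b; rewrite !expoD expoB expo_x expo_to_vars.
by case: eqP => [->|_]; rewrite ?ltnSn; lia.
Qed.

(** In the first [a] variables both sides say that the excess of the exponent of
    [p_i] over that of [p_j] is at most the exponent of [w].  In [x] the right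
    side holds by the second ordering condition, so truncating [m_ij] to the
    first [a] variables loses nothing. *)
Lemma lem_syzygy i j (w : 'X_{1..a}) : (i < j)%N -> new_gen p a j ->
  (to_vars a (mmon p i j) <= w)%MM =
  (lift_gen i <= lift_gen j + to_vars a.+1 w)%MM.
Proof.
move=> lt_ij pj; have lt_j := new_gen_lt pj.
have lt_i := ltn_trans lt_ij lt_j.
have := pj; rewrite new_genP // => /andP[vj _].
have vi := ordered_in_vars lt_ij lt_j vj.
have le_ij : (expo (gen p i) a <= expo (gen p j) a)%N.
  by apply: p_powers; rewrite ?gen_mem_gens.
apply/lem_expoP/lem_expoP => le_w b; have := le_w b;
  rewrite expoD !expo_to_vars expoB expo_lcm.
  by rewrite ltnS; case: (ltngtP b a) => [lt_b|//|->] /=; lia.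
by rewrite ltnS; case: (ltngtP b a) => [lt_b|//|->] /=; lia.
Qed.

Lemma in_mono_syzygyP j (w : 'X_{1..a}) : new_gen p a j ->
  reflect
    (exists2 i, (i < j)%N & (lift_gen i <= lift_gen j + to_vars a.+1 w)%MM)
    (in_mono (syzygy_monos j) w).
Proof.
move=> pj; apply: (iffP hasP) => [[_ /mapP[i + ->]]|[i lt_ij le_i]].
  by rewrite mem_iota => /= lt_ij; rewrite lem_syzygy //; exists i.
exists (to_vars a (mmon p i j)); last by rewrite lem_syzygy.
by apply: map_f; rewrite mem_iota.
Qed.

Lemma in_mono_idealP u :
  reflect (exists i,
      [/\ (i < size p)%N, in_vars a.+1 (gen p i) & (lift_gen i <= u)%MM])
    (in_mono ideal_monos u).
Proof.
apply: (iffP hasP) => [[_ /mapP[m /mem_gensP[i [lt_i vi ->]] ->] le_u]|].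
  by exists i.
case=> i [lt_i vi le_u]; exists (lift_gen i) => //; apply: map_f.
by rewrite gen_mem_gens.
Qed.

Lemma first_gen_lt u : in_colon u -> (first_gen u < size p)%N.
Proof.
case/andP => _ /in_mono_idealP[i [lt_i vi le_u]]; rewrite -has_find.
by apply/hasP; exists (gen p i); rewrite ?mem_nth ?vi.
Qed.

Lemma lem_first_gen u : in_colon u ->
  in_vars a.+1 (gen p (first_gen u)) /\ (lift_gen (first_gen u) <= u + x)%MM.
Proof.
by move=> /first_gen_lt; rewrite -has_find => /(nth_find 0%MM)/andP[].
Qed.

(** The generator divides [u x] but not [u], so its exponent of [x] exceeds that
    of [u], by one at most. *)
Lemma expo_first_gen u : in_colon u ->
  expo (gen p (first_gen u)) a = (expo u a).+1.
Proof.
move=> uC; have [vj /lem_expoP le_j] := lem_first_gen uC.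
have lt_j := first_gen_lt uC; set j := first_gen u in vj le_j lt_j *.
apply/eqP; rewrite eqn_leq; apply/andP; split.
  have := le_j a; rewrite expoD expo_x eqxx expo_to_vars ltnSn; lia.
rewrite ltnNge; case/andP: uC => + _; apply: contra => le_a.
apply/in_mono_idealP; exists j; split => //; apply/lem_expoP => b.
have := le_j b; rewrite expoD expo_x expo_to_vars.
by case: eqP => [->|_]; rewrite ?ltnSn //; lia.
Qed.

Lemma first_gen_new u : in_colon u -> new_gen p a (first_gen u).
Proof.
move=> uC; rewrite new_genP ?first_gen_lt // expo_first_gen //.
by have [-> _] := lem_first_gen uC.
Qed.

(** The heart of the proof: the monomials of the colon module whose first
    generator is [p_j] are the products [q_j w], for [w] outside the ideal of
    the [m_ij]. *)
Lemma fiberP j u : new_gen p a j ->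
  reflect (exists2 w, ~~ in_mono (syzygy_monos j) w
                    & u = (qmon p a j + to_vars a.+1 w)%MM)
    (in_colon u && (first_gen u == j)).
Proof.
move=> pj; have lt_j := new_gen_lt pj.
have := pj; rewrite new_genP // => /andP[vj pj0].
apply: (iffP andP) => [[uC /eqP ju]|[w wG uE]].
  have ua := expo_first_gen uC; have [_ /lem_expoP le_j] := lem_first_gen uC.
  rewrite ju in ua le_j.
  have uE : u = (qmon p a j + to_vars a.+1 (to_vars a (u - qmon p a j)))%MM.
    apply: expo_inj => b; have := le_j b.
    rewrite !(expoD, expoB, expo_to_vars, expo_x).
    rewrite ltnS; case: (ltngtP b a) => [lt_b|lt_b|->] /=; try lia.
    by rewrite [expo u b]expo_default.
  exists (to_vars a (u - qmon p a j)) => //.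
  (* An earlier [p_i] dividing [p_j w = u x] would contradict minimality. *)
  apply/in_mono_syzygyP => // -[i lt_ij]; rewrite -qmonE // -uE => le_i.
  rewrite -ju in lt_ij; have := before_find 0%MM lt_ij.
  by rewrite -/(gen p i) le_i andbT (ordered_in_vars _ lt_j vj) // -ju.
have uxE : (u + x = lift_gen j + to_vars a.+1 w)%MM by rewrite uE qmonE.
have no_i i : (lift_gen i <= u + x)%MM -> (j <= i)%N.
  rewrite leqNgt uxE => le_i; apply: contra wG => lt_ij.
  by apply/in_mono_syzygyP => //; exists i.
have uC : in_colon u.
  apply/andP; split; last first.
    by apply/in_mono_idealP; exists j; rewrite uxE lem_addr.
  apply/in_mono_idealP => -[i [lt_i vi le_i]].
  (* [p_i] has at least the exponent of [x] of [p_j], one more than [u]. *)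
  have le_ji := no_i i (lepm_trans le_i (lem_addr _ _)).
  have: (expo (gen p j) a <= expo (gen p i) a)%N.
    move: le_ji; rewrite leq_eqVlt => /predU1P[->|lt_ji] //.
    by apply: p_powers; rewrite ?gen_mem_gens.
  have /lem_expoP/(_ a) := le_i.
  rewrite uE !(expoD, expoB, expo_to_vars, expo_x) ltnSn eqxx.
  by rewrite [expo w a]expo_default //; lia.
split=> //; have [_ /no_i le_j] := lem_first_gen uC.
rewrite eqn_leq le_j andbT leqNgt; apply/negP => /(before_find 0%MM).
by rewrite -/(gen p j) vj uxE lem_addr.
Qed.

Lemma count_fiber j t : new_gen p a j ->
  count (fun u => in_colon u && (first_gen u == j)) (deg_monos a.+1 t) =
  if (mdeg (qmon p a j) <= t)%N
  then count (fun w => ~~ in_mono (syzygy_monos j) w)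
         (deg_monos a (t - mdeg (qmon p a j))%N)
  else 0%N.
Proof.
move=> pj; case: leqP => [le_t|lt_t]; last first.
  apply/eqP; rewrite -leqn0 leqNgt -has_count; apply/hasP => -[u].
  rewrite mem_deg_monos => /eqP ut /(fiberP _ pj)[w _ uE].
  by move: lt_t; rewrite -ut uE mdegD ltnNge leq_addr.
pose f w := (qmon p a j + to_vars a.+1 (w : 'X_{1..a}))%MM.
have f_inj : injective f.
  move=> w w' /addmI eq_w; apply: expo_inj => b.
  have [lt_b|le_b] := ltnP b a; last by rewrite !expo_default.
  have := congr1 (fun m => expo m b) eq_w; rewrite /= !expo_to_vars.
  by rewrite ltnS ltnW.
rewrite -!size_filter -(size_map f); apply: perm_size; apply: uniq_perm.
- by rewrite filter_uniq ?deg_monos_uniq.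
- by rewrite map_inj_uniq // filter_uniq ?deg_monos_uniq.
move=> u; rewrite mem_filter mem_deg_monos.
apply/andP/mapP => [[/(fiberP _ pj)[w wG uE] /eqP ut]|[w]].
  exists w => //; rewrite mem_filter wG mem_deg_monos -ut uE mdegD.
  by rewrite mdeg_to_vars addKn eqxx.
rewrite mem_filter mem_deg_monos => /andP[wG /eqP wt] ->.
split; first by apply/fiberP => //; exists w.
by rewrite mdegD mdeg_to_vars wt subnKC.
Qed.

End Colon.

(** * The formula *)

Lemma HF_shift (k : fieldType) (V : lmodType k) (M : nat -> V -> Prop)
    (t e : nat) :
  HF M (t%:Z - e%:Z) = if (e <= t)%N then HF M (t - e)%N else 0%N.
Proof.
case: leqP => [le_et|lt_te]; first by rewrite subzn.
have -> : t%:Z - e%:Z = Negz (e - t).-1 by lia.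
by [].
Qed.

Lemma HF_neg (k : fieldType) (V : lmodType k) (M : nat -> V -> Prop)
    (t e : nat) :
  HF M (Negz t - e%:Z) = 0%N.
Proof. by have -> : Negz t - e%:Z = Negz (t + e) by lia. Qed.

(* The index a.+1 is the integer >= 1 of the statement; x_(a+1) is the last
   variable of k[x_1, ..., x_(a+1)]. *)
Theorem theorem5p1 (k : fieldType) (d : nat) (p : seq 'X_{1..d})
    (p_uniq : uniq p)
    (p_pos : forall m, m \in p -> (0 < mdeg m)%N)
    (p_vars : ordered_by_vars p) (p_powers : ordered_by_powers p)
    (a : nat) (t : int) :
  HF (colon_gr (Igens k p a.+1) 'X_ord_max) t =
    (new_gen p a 0 * HF (poly_gr k a) (t - (mdeg (qmon p a 0))%:Z) +
     \sum_(1 <= j < size p | new_gen p a j)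
        HF (quo_gr (mgens k p a j)) (t - (mdeg (qmon p a j))%:Z))%N.
Proof.
case: t => t; last first.
  by rewrite HF_neg muln0 big1 // => j _; rewrite HF_neg.
rewrite /Igens map_comp HF_colon_gr -/(ideal_monos p a).
rewrite (eq_count (a2 := @in_colon d p a)) //.
rewrite (count_fibers _ (@first_gen_lt d p a)).
have fiber j :
    count (fun u => in_colon p u && (first_gen p u == j)) (deg_monos a.+1 t) =
    (new_gen p a j *
     HF (quo_gr (mgens k p a j)) (t%:Z - (mdeg (qmon p a j))%:Z))%N.
  case: (boolP (new_gen p a j)) => [pj|/negP pj].
    by rewrite count_fiber // mul1n HF_shift /mgens map_comp HF_quo_gr.
  apply/eqP; rewrite -leqn0 leqNgt -has_count; apply/hasP => -[u _].
  by case/andP=> uC /eqP ju; apply: pj; rewrite -ju first_gen_new.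
under eq_bigr => j _ do rewrite fiber.
(* For the first generator the ideal of the [m_ij] is zero. *)
have poly0 : HF (quo_gr (mgens k p a 0)) =1 HF (poly_gr k a).
  case=> // n; rewrite (HF_quo_gr k [::]) HF_poly_gr -count_predT.
  exact: eq_count.
rewrite [in RHS]big_mkcond /=; case: (posnP (size p)) => [p0|p_gt0].
  rewrite p0 !big_geq // (_ : new_gen p a 0 = false) //.
  by apply/negP => /new_gen_lt; rewrite p0.
rewrite big_ltn // poly0; congr (_ + _)%N; apply: eq_bigr => j _.
by case: new_gen; rewrite ?mul1n.
Qed.
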